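(* Let $f\colon T_1\to T_2$ and $h\colon T_1'\to T_2'$ be homomorphisms of complex tori. If there exist isomorphisms $h_1\colon T_1\to T_1'$ and $h_2\colon T_2'\to T_2$ of complex tori such that $f=h_2\circ h\circ h_1$, then $f$ and $h$ have the same type.
   Context: A complex torus of dimension $g$ is a quotient $T=V/L$ of a complex vector space $V$ of dimension $g$ by a lattice $L$ (a discrete subgroup of $V$ of rank $2g$ generating $V$ as a real vector space). A homomorphism $f\colon T_1=V_1/L_1\to T_2=V_2/L_2$ of complex tori (a holomorphic group homomorphism) is induced by a $\mathbb C$-linear map $\rho_a(f)\colon V_1\to V_2$ with $\rho_a(f)(L_1)\subseteq L_2$ (the analytic representation); its restriction $\rho_r(f)\colon L_1\to L_2$ is the rational representation. $[\rho_r(f)]$ denotes the integral matrix of $\rho_r(f)$, of size $2\dim T_2\times 2\dim T_1$, with respect to chosen $\mathbb Z$-bases of $L_1$ and $L_2$. For $k\ge 1$, the $k$-th determinantal divisor $\delta_k(f)$ is the (positive) greatest common divisor of the minors of order $k$ of $[\rho_r(f)]$ if at least one of them is non-zero, and $\delta_k(f)=0$ otherwise; also $\delta_0(f):=1$. These do not depend on the choice of bases. If $r$ is the rank of $[\rho_r(f)]$, set $d_k(f):=\delta_k(f)/\delta_{k-1}(f)\in\mathbb Z_{>0}$ for $1\le k\le r$. The type of $f$ is the vector $(d_1(f),\ldots,d_r(f))$. *)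

(* Defs.v *)
From HB Require Import structures.
From mathcomp Require Import all_boot all_order all_algebra ring_quotient.
From mathcomp Require Import complex.
From mathcomp Require Import boolp classical_sets reals topology normedtype.
From mathcomp Require Import derive.

Set Implicit Arguments.
Unset Strict Implicit.
Unset Printing Implicit Defensive.

Import Order.TTheory GRing.Theory Num.Theory.
Import numFieldNormedType.Exports.
Import VectorInternalTheory.

Local Open Scope classical_set_scope.
Local Open Scope quotient_scope.
Local Open Scope ring_scope.

(* [R[i]] packaged as a [numClosedFieldType]: the normed-module structures of
   MathComp-Analysis on a field and on its row vectors are found through the
   projection of such a package, and not on the bare type [R[i]]. *)
Definition Cfield (R : realType) : numClosedFieldType := R[i].

Definition real_to_C (R : realType) (a : R) : Cfield R := a%:C%C.

Section Lattice.
Context (R : realType) (V : vectType (Cfield R)).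

Definition is_zbasis (L : {pred V}) (n : nat) (b : 'I_n -> V) : Prop :=
  (forall i, b i \in L) /\
  (forall v, v \in L ->
     exists! c : {ffun 'I_n -> int}, v = \sum_i b i *~ c i).

(* The topology of the finite-dimensional space [V] is the one transported from
   ['rV_(dim V)] by the coordinate isomorphism [v2r]. *)
Definition discrete_subset (L : {pred V}) : Prop :=
  forall x, x \in L -> isolated [set v2r y | y in [set y | y \in L]] (v2r x).

Definition generates_over_R (L : {pred V}) : Prop :=
  forall v : V, exists (n : nat) (l : 'I_n -> V) (a : 'I_n -> R),
    (forall i, l i \in L) /\ v = \sum_i real_to_C (a i) *: l i.

Definition is_lattice (L : zmodClosed V) : Prop :=
  [/\ discrete_subset L,
      exists b : 'I_((dim V).*2) -> V, is_zbasis L b &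
      generates_over_R L].

End Lattice.

Record complexTorus (R : realType) := ComplexTorus {
  tspace : vectType (Cfield R);
  tlattice : zmodClosed tspace;
  tlatticeP : is_lattice tlattice }.

Definition torus_group (R : realType) (T : complexTorus R) : zmodType :=
  Quotient.quot (tlattice T).

Coercion torus_group : complexTorus >-> GRing.Zmodule.type.

Definition tproj (R : realType) (T : complexTorus R) (v : tspace T) : T :=
  \pi_(Quotient.quot (tlattice T)) v.

Definition tdim (R : realType) (T : complexTorus R) : nat := dim (tspace T).

Definition tproj_coord (R : realType) (T : complexTorus R)
    (x : 'rV[Cfield R]_(tdim T)) : T :=
  tproj (@r2v _ (tspace T) x).

Section Homomorphisms.
Context (R : realType).
Implicit Types T : complexTorus R.

(* The holomorphic charts of [V / L] are the local inverses of the projection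
   [V -> V / L], read in the coordinates [v2r]. Hence [f] is holomorphic when
   it lifts, near every point, to a map [F] between the coordinate spaces which
   is complex differentiable in a neighbourhood of that point. *)
Definition holomorphic T1 T2 (f : T1 -> T2) : Prop :=
  forall a : 'rV[Cfield R]_(tdim T1),
  exists F : 'rV[Cfield R]_(tdim T1) -> 'rV[Cfield R]_(tdim T2),
    \forall x \near a,
      f (tproj_coord x) = tproj_coord (F x) /\ differentiable F x.

Record torusHom T1 T2 := TorusHom {
  hom_fun :> {additive T1 -> T2};
  hom_holomorphic : holomorphic hom_fun }.

Definition is_isomorphism T1 T2 (f : torusHom T1 T2) : Prop :=
  exists g : torusHom T2 T1, cancel f g /\ cancel g f.

(* The default value 0 is never used: a homomorphism of complex tori is induced
   by a unique linear map, which maps the lattice into the lattice. *)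
Definition analytic_rep T1 T2 (f : torusHom T1 T2) :
    'Hom(tspace T1, tspace T2) :=
  xget 0 [set F : 'Hom(tspace T1, tspace T2) |
           forall v, f (tproj v) = tproj (F v)].

(* Matrix of the restriction of [analytic_rep f] to the lattices: column [j]
   holds the coordinates of the image of [b1 j] in the basis [b2]. *)
Definition rational_rep_mx T1 T2 (f : torusHom T1 T2)
    (b1 : 'I_((tdim T1).*2) -> tspace T1)
    (b2 : 'I_((tdim T2).*2) -> tspace T2) :
    'M[int]_((tdim T2).*2, (tdim T1).*2) :=
  xget 0 [set M : 'M[int]_((tdim T2).*2, (tdim T1).*2) |
           forall j, analytic_rep f (b1 j) = \sum_i b2 i *~ M i j].

End Homomorphisms.

Section DeterminantalDivisors.
Context (m n : nat).
Implicit Type M : 'M[int]_(m, n).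

Definition increasing (k l : nat) (s : {ffun 'I_k -> 'I_l}) : bool :=
  [forall i : 'I_k, forall j : 'I_k, (i < j)%N ==> (s i < s j)%N].

(* Since [gcdn 0 0 = 0], this is 0 when all the minors of order [k] vanish, in
   particular when there are none; for [k = 0] the only minor is the empty
   determinant 1, see [detdiv0]. *)
Definition detdiv M (k : nat) : nat :=
  \big[gcdn/0%N]_(r : {ffun 'I_k -> 'I_m} | increasing r)
    \big[gcdn/0%N]_(c : {ffun 'I_k -> 'I_n} | increasing c)
      `|\det (mxsub r c M)|%N.

Lemma detdiv0 M : detdiv M 0 = 1%N.
Proof.
have inc0 l (s : {ffun 'I_0 -> 'I_l}) : increasing s by apply/forallP; case.
rewrite /detdiv (eq_bigr (fun=> 1%N)) => [|r _].
  rewrite (big_pred1 [ffun i : 'I_0 => False_rect _ (notF (ltn_ord i))]) // => r.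
  by rewrite inc0; apply/esym/eqP/ffunP; case.
rewrite (big_pred1 [ffun i : 'I_0 => False_rect _ (notF (ltn_ord i))]) ?det_mx00 // => c.
by rewrite inc0; apply/esym/eqP/ffunP; case.
Qed.

(* The natural-number quotients are exact: expanding along a row shows that
   [detdiv M k] divides [detdiv M k.+1]. *)
Definition mx_type M : seq nat :=
  [seq (detdiv M k.+1 %/ detdiv M k)%N
     | k <- iota 0 (\rank (map_mx intr M : 'M[rat]_(m, n)))].

End DeterminantalDivisors.

(* The value does not depend on the Z-bases [b1] and [b2] of the two lattices. *)
Definition hom_type (R : realType) (T1 T2 : complexTorus R)
    (f : torusHom T1 T2)
    (b1 : 'I_((tdim T1).*2) -> tspace T1)
    (b2 : 'I_((tdim T2).*2) -> tspace T2) : seq nat :=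
  mx_type (rational_rep_mx f b1 b2).

(* Main.v *)
Require Import Defs.
From HB Require Import structures.
From mathcomp Require Import all_boot all_order all_algebra ring_quotient.
From mathcomp Require Import fingroup perm complex.
From mathcomp Require Import boolp classical_sets reals topology normedtype.
From mathcomp Require Import landau derive.

Set Implicit Arguments.
Unset Strict Implicit.
Unset Printing Implicit Defensive.

(** The type of a homomorphism is read off an integral matrix, and two things
    have to be seen: composing homomorphisms multiplies the matrices, and the
    determinantal divisors and the rank of an integral matrix cannot tell [N]
    from [M] when each is a product [A *m _ *m B] around the other.

    The first point rests on the fact that every homomorphism of complex tori
    is induced by exactly one linear map ([lift_exists], [lift_unique]).
    Near 0 the homomorphism lifts to a map [G] between the coordinate spaces
    with [G 0 = 0]. Since [2 *: G (x / 2)] and [G x] have the same image in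
    the target and are both small, discreteness of the lattice forces them to
    be equal; so [G x = 2 ^+ n *: G (x / 2 ^+ n)] for all [n], and this tends
    to the derivative of [G] at 0 applied to [x]. Hence [G] coincides with its
    derivative near 0, and additivity propagates the identity to the whole
    torus. Uniqueness holds because a discrete subgroup contains no complex
    line. Uniqueness makes the analytic representation functorial, and
    expanding in bases turns this into [rational_rep_mx_comp3].

    For the second point, each minor of order [k] of [A *m N] is an integral
    combination of minors of order [k] of [N] ([det_mxsub_mul]), and likewise
    for [N *m B] by transposition; thus [detdiv N k] divides
    [detdiv (A *m N *m B) k]. When [M] and [N] are both of this form with
    respect to each other, the two divisors agree; ranks agree for the same
    reason ([mx_type_equiv]). No equality between the sizes of [M] and [N] is
    involved, so the dimensions of the isomorphic tori never have to be
    identified. The theorem follows from [f = h2 \o h \o h1] and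
    [h = h2^-1 \o f \o h1^-1]. *)

Import Order.TTheory GRing.Theory Num.Theory.
Import numFieldNormedType.Exports.
Import VectorInternalTheory.

Local Open Scope classical_set_scope.
Local Open Scope quotient_scope.
Local Open Scope ring_scope.

(** * Minors of products and determinantal divisors *)

(** Multilinearity of the determinant in the rows. Summing over all maps [s],
    and not only over the increasing ones as in the Cauchy-Binet formula, is
    enough for divisibility: the cancellation between selections that differ by
    a permutation never has to be carried out. *)
Lemma det_mxsub_mul (R : comRingType) (k m p n : nat)
    (A : 'M[R]_(m, p)) (B : 'M[R]_(p, n)) (r : 'I_k -> 'I_m) (c : 'I_k -> 'I_n) :
  \det (mxsub r c (A *m B)) =
  \sum_(s : {ffun 'I_k -> 'I_p}) (\prod_i A (r i) (s i)) * \det (mxsub s c B).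
Proof.
under [RHS]eq_bigr => s _ do rewrite /determinant big_distrr /=.
rewrite exchange_big; apply: eq_bigr => /= t _.
transitivity ((-1) ^+ t * \sum_(s : {ffun 'I_k -> 'I_p})
   \prod_i (A (r i) (s i) * B (s i) (c (t i)))).
  rewrite -(bigA_distr_bigA (fun i j => A (r i) j * B j (c (t i)))).
  by congr (_ * _); apply: eq_bigr => i _; rewrite !mxE.
rewrite big_distrr; apply: eq_bigr => s _ /=.
rewrite big_split /= mulrCA; congr (_ * (_ * _)).
by apply: eq_bigr => i _; rewrite mxE.
Qed.

(** Arbitrary maps are allowed as row and column selections, which makes the
    predicate stable under products and transposition without any sorting. *)
Definition minors_dvd (k m n : nat) (d : nat) (M : 'M[int]_(m, n)) : Prop :=
  forall (r : 'I_k -> 'I_m) (c : 'I_k -> 'I_n), (d %| \det (mxsub r c M))%Z.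

Lemma minors_dvd_tr k m n d (M : 'M[int]_(m, n)) :
  minors_dvd k d M -> minors_dvd k d M^T.
Proof. by move=> dM r c; rewrite -trmx_mxsub det_tr. Qed.

Lemma minors_dvd_mull k m p n d (A : 'M[int]_(m, p)) (M : 'M[int]_(p, n)) :
  minors_dvd k d M -> minors_dvd k d (A *m M).
Proof.
move=> dM r c; rewrite det_mxsub_mul; apply: rpred_sum => s _.
by apply: dvdz_mull; exact: dM.
Qed.

Lemma minors_dvd_mulr k m p n d (M : 'M[int]_(m, p)) (B : 'M[int]_(p, n)) :
  minors_dvd k d M -> minors_dvd k d (M *m B).
Proof.
move=> /minors_dvd_tr dM; rewrite -[M *m B]trmxK trmx_mul.
by apply: minors_dvd_tr; exact: minors_dvd_mull.
Qed.

Lemma sort_injective_ffun (k l : nat) (s : 'I_k -> 'I_l) : injective s ->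
  exists (t : {ffun 'I_k -> 'I_l}) (u : 'S_k), increasing t /\ s =1 t \o u.
Proof.
move=> s_inj.
have cI : k = #|codom s| by rewrite card_codom // card_ord.
pose t := [ffun i => enum_val (cast_ord cI i)] : {ffun 'I_k -> 'I_l}.
pose v i := cast_ord (esym cI) (enum_rank_in (codom_f s i) (s i)).
have tv i : t (v i) = s i.
  by rewrite ffunE cast_ordKV enum_rankK_in ?codom_f.
have v_inj : injective v by move=> i j vij; apply: s_inj; rewrite -!tv vij.
exists t, (perm v_inj); split; last by move=> i /=; rewrite permE tv.
apply/forallP => i; apply/forallP => j; apply/implyP => ij.
rewrite !ffunE.
rewrite !(enum_val_nth (s i)) /= -!(nth_map _ 0%N val) -?cardE -?cI //.
have srt : sorted ltn (map val (enum (codom s))).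
  have := iota_ltn_sorted 0 l; rewrite -val_enum_ord.
  apply: (subseq_sorted ltn_trans).
  by apply: map_subseq; rewrite enumT; exact: filter_subseq.
by rewrite (sorted_ltn_nth ltn_trans 0%N srt) ?inE ?size_map -?cardE -?cI.
Qed.

(** A selection with a repeated row gives the determinant 0; any other one is an
    increasing selection up to a permutation of the rows, which only affects the
    sign. *)
Lemma minors_dvd_increasing_row k m n d (M : 'M[int]_(m, n)) (c : 'I_k -> 'I_n) :
  (forall r : {ffun 'I_k -> 'I_m}, increasing r -> (d %| \det (mxsub r c M))%Z) ->
  forall r : 'I_k -> 'I_m, (d %| \det (mxsub r c M))%Z.
Proof.
move=> dM r; have [/injectiveP/sort_injective_ffun [t [u [tinc rE]]]|] := boolP (injectiveb r).
  have -> : mxsub r c M = perm_mx u *m mxsub t c M.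
    by rewrite -row_permE; apply/matrixP => i j; rewrite !mxE rE.
  by rewrite det_mulmx dvdz_mull ?dM.
case/injectivePn => i [j /negPf ij rij]; rewrite (determinant_alternate (negbT ij)) ?dvdz0 //.
by move=> l; rewrite !mxE rij.
Qed.

Lemma dvdn_biggcdn (I : finType) (P : pred I) (F : I -> nat) d :
  reflect (forall i, P i -> (d %| F i)%N) (d %| \big[gcdn/0%N]_(i | P i) F i)%N.
Proof.
apply: (iffP idP) => [dF i Pi|dF].
  by apply: dvdn_trans dF _; rewrite (bigD1 i) //= dvdn_gcdl.
apply: (big_ind (dvdn d)) => // [x y dx dy].
by rewrite dvdn_gcd dx.
Qed.

Lemma dvdn_detdivP k m n d (M : 'M[int]_(m, n)) :
  (d %| detdiv M k)%N <-> minors_dvd k d M.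
Proof.
split=> [/dvdn_biggcdn dM r c|dM].
  apply: minors_dvd_increasing_row => {}r /dM /dvdn_biggcdn {}dM.
  rewrite -det_tr trmx_mxsub; apply: minors_dvd_increasing_row => {}c /dM.
  by rewrite -trmx_mxsub det_tr /dvdz.
by apply/dvdn_biggcdn => r _; apply/dvdn_biggcdn => c _; have:= dM r c.
Qed.

Lemma detdiv_mul k m p q n (A : 'M[int]_(m, p)) (N : 'M[int]_(p, q))
    (B : 'M[int]_(q, n)) : (detdiv N k %| detdiv (A *m N *m B) k)%N.
Proof.
apply/dvdn_detdivP/minors_dvd_mulr/minors_dvd_mull; exact/dvdn_detdivP.
Qed.

(** Each equation gives divisibility of the determinantal divisors in one
    direction and an inequality of ranks in the other. *)
Lemma mx_type_equiv m n p q (M : 'M[int]_(m, n)) (N : 'M[int]_(p, q)) A B A' B' :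
  M = A *m N *m B -> N = A' *m M *m B' -> mx_type M = mx_type N.
Proof.
have rk a b c e (X : 'M[int]_(a, b)) (Y : 'M_(b, c)) (Z : 'M_(c, e)) :
  (\rank (map_mx intr (X *m Y *m Z) : 'M[rat]_(a, e))
     <= \rank (map_mx intr Y : 'M[rat]_(b, c)))%N.
  rewrite !map_mxM; exact: leq_trans (mxrankM_maxl _ _) (mxrankM_maxr _ _).
move=> MN NM.
have dE k : detdiv M k = detdiv N k.
  by apply/eqP; rewrite eqn_dvd [in X in X && _]NM [in X in _ && X]MN !detdiv_mul.
have rE : \rank (map_mx intr M : 'M[rat]_(m, n))
        = \rank (map_mx intr N : 'M[rat]_(p, q)).
  by apply/eqP; rewrite eqn_leq [in X in X && _]MN [in X in _ && X]NM !rk.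
by rewrite /mx_type rE; apply: eq_map => k; rewrite !dE.
Qed.

Section Torus.
Context (R : realType).
Local Notation C := (Cfield R).

(** * The covering of a torus and its lattice *)

Lemma tproj_is_additive (T : complexTorus R) : zmod_morphism (@tproj R T).
Proof. by move=> x y; rewrite /tproj raddfB. Qed.

HB.instance Definition _ (T : complexTorus R) :=
  GRing.isZmodMorphism.Build (tspace T) (T : zmodType) (@tproj R T)
    (@tproj_is_additive T).

Lemma tproj_coord_is_additive (T : complexTorus R) :
  zmod_morphism (@tproj_coord R T).
Proof. by move=> x y; rewrite /tproj_coord linearB raddfB. Qed.

HB.instance Definition _ (T : complexTorus R) :=
  GRing.isZmodMorphism.Build 'rV[C]_(tdim T) (T : zmodType) (@tproj_coord R T)
    (@tproj_coord_is_additive T).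

Lemma tproj_eq0 (T : complexTorus R) (v : tspace T) :
  (tproj v == 0) = (v \in tlattice T).
Proof.
by rewrite -[v in RHS]subr0 Quotient.idealrBE raddf0.
Qed.

Lemma lattice_isolated0 (T : complexTorus R) :
  exists2 e : C, 0 < e &
    forall v, v \in tlattice T -> `|v2r v| < e -> v = 0.
Proof.
have [disc _ _] := tlatticeP T.
have [_ [U /nbhs_ballP[e /= e0 eU] UL]] := disc 0 (rpred0 _).
exists e => // v vL ve; apply: v2r_inj.
suff : [set v2r (0 : tspace T)] (v2r v) by [].
rewrite -UL; split; last by exists v.
by apply: eU; rewrite -ball_normE /= linear0 sub0r normrN.
Qed.

(** A nonzero line would meet every neighbourhood of 0 in a nonzero point. *)
Lemma line_in_lattice_eq0 (T : complexTorus R) (w : tspace T) :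
  (forall c : C, c *: w \in tlattice T) -> w = 0.
Proof.
move=> wL; have [e e0 eL] := lattice_isolated0 T.
have n0 : 0 < `|v2r w| + 1 by rewrite ltr_wpDl ?normr_ge0.
pose c : C := e / (`|v2r w| + 1).
have c0 : 0 < c by rewrite divr_gt0.
have /eqP : c *: w = 0.
  apply: eL; rewrite ?wL// linearZ normrZ gtr0_norm //.
  by rewrite /c mulrAC ltr_pdivrMr // ltr_pM2l // ltrDl.
by rewrite scaler_eq0 gt_eqF //= => /eqP.
Qed.

(** A positive complex number is real, so this is the archimedean property of
    [R]. *)
Lemma cfield_archi (d : C) : 0 < d -> exists n : nat, (2 ^+ n)^-1 < d.
Proof.
case: d => a b; rewrite ltcE /= => /andP[/eqP b0 a0].
exists (Num.truncn a^-1).+1; rewrite {}b0 /Cfield.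
rewrite -[2]/(2%:R) -(rmorph_nat (@real_complex R)) -rmorphXn -fmorphV ltcR.
rewrite invf_plt ?posrE ?exprn_gt0 // (lt_trans (truncnS_gt _)) //.
by rewrite -natrX ltr_nat ltn_expl.
Qed.

Lemma halving_small (k : nat) (w : 'rV[C]_k) (d : C) : 0 < d ->
  exists n, `|(2 ^+ n)^-1 *: w| < d.
Proof.
move=> d0; have w0 : 0 < `|w| + 1 by rewrite ltr_wpDl ?normr_ge0.
have [n nd] := cfield_archi (divr_gt0 d0 w0); exists n.
rewrite ltr_pdivlMr // in nd; apply: le_lt_trans nd.
by rewrite normrZ ger0_norm ?invr_ge0 ?exprn_ge0 // ler_wpM2l ?invr_ge0 ?exprn_ge0 // lerDl.
Qed.

(** * The linear map inducing a homomorphism *)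

(** The difference of two lifts maps every complex line into the lattice. *)
Lemma lift_unique (T1 T2 : complexTorus R) (F G : 'Hom(tspace T1, tspace T2)) :
  (forall v, tproj (F v) = tproj (G v)) -> F = G.
Proof.
move=> FG; apply/lfunP => v; apply/eqP; rewrite -subr_eq0; apply/eqP.
apply: line_in_lattice_eq0 => c.
by rewrite -tproj_eq0 scalerBr -!linearZ raddfB /= FG subrr.
Qed.

(** A local holomorphic lift is compatible with halving, by discreteness of the
    lattice; hence it agrees with its derivative near 0. *)
Lemma lift_exists (T1 T2 : complexTorus R) (f : torusHom T1 T2) :
  exists F : 'Hom(tspace T1, tspace T2), forall v, f (tproj v) = tproj (F v).
Proof.
have [F0 F0P] := hom_holomorphic f 0.
have [F00 dF0] := nbhs_singleton F0P.
have F00' : tproj_coord (F0 0) = 0.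
  by rewrite -F00 !raddf0.
have [e e0 eL] := lattice_isolated0 T2.
pose G x := F0 x - F0 0.
have e3 : 0 < e / 3 by rewrite divr_gt0.
have Gsmall : \forall x \near (0 : 'rV[C]_(tdim T1)), `|G x| < e / 3.
  have /cvgrPdist_lt /(_ _ e3) := differentiable_continuous dF0.
  by apply: filterS => x; rewrite distrC.
have fG : \forall x \near (0 : 'rV[C]_(tdim T1)),
    f (tproj_coord x) = tproj_coord (G x).
  apply: filterS F0P => x [fx _].
  by rewrite fx raddfB /= F00' subr0.
have [d /= d0 dP] : exists2 d : C, 0 < d & forall x : 'rV[C]_(tdim T1),
    `|x| < d -> f (tproj_coord x) = tproj_coord (G x) /\ `|G x| < e / 3.
  have : \forall x \near (0 : 'rV[C]_(tdim T1)),
      f (tproj_coord x) = tproj_coord (G x) /\ `|G x| < e / 3 by exact: filterI.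
  move=> /nbhs_norm0P[d /= d0 dP].
  by exists d => // x xd; apply: dP.
(* The difference of the two sides lies in the lattice and is shorter than [e]. *)
have half x : `|x| < d -> G x = 2 *: G (2^-1 *: x).
  move=> xd.
  have hd : `|2^-1 *: x| < d.
    rewrite normrZ ger0_norm ?invr_ge0 // mulrC ltr_pdivrMr //.
    by rewrite (lt_le_trans xd) // ler_peMr ?ler1n // ltW.
  have [fx Gx] := dP _ xd; have [fh Gh] := dP _ hd.
  apply: (can_inj r2vK); apply/eqP; rewrite -subr_eq0 -linearB; apply/eqP.
  apply: eL.
    rewrite -tproj_eq0 -/(tproj_coord _) raddfB /= scaler_nat raddfMn /= -fx -fh.
    have {1}-> : x = (2^-1 *: x) *+ 2.
      by rewrite -scaler_nat scalerA divff ?pnatr_eq0 // scale1r.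
    by rewrite 2!raddfMn subrr.
  rewrite r2vK (le_lt_trans (ler_normB _ _)) // normrZ normr_nat.
  apply: (@lt_le_trans _ _ (e / 3 + 2 * (e / 3))).
    by rewrite ltrD // ltr_pM2l.
  by rewrite -[X in X + _]mul1r -mulrDl nat1r mulrC divfK ?pnatr_eq0.
have halfn n x : `|x| < d -> G x = 2 ^+ n *: G ((2 ^+ n)^-1 *: x).
  move=> xd; elim: n => [|n IH]; first by rewrite expr0 invr1 !scale1r.
  rewrite IH half ?scalerA -?exprSr -?invfM -?exprS //.
  rewrite normrZ ger0_norm ?invr_ge0 ?exprn_ge0 // mulrC.
  rewrite ltr_pdivrMr ?exprn_gt0 // (lt_le_trans xd) //.
  by apply: ler_peMr; [exact: ltW | rewrite exprn_ege1 // ler1n].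
pose D : {linear 'rV[C]_(tdim T1) -> 'rV[C]_(tdim T2)} := 'd F0 0.
(* The relative error of [D] at [x] equals its relative error at the points
   [x / 2 ^+ n], which tends to 0. *)
have GD x : `|x| < d -> G x = D x.
  move=> xd.
  have De t : 0 < t -> `|G x - D x| <= t * `|x|.
    move=> t0.
    have /eqaddoP /(_ _ t0) /nbhs_norm0P[r /= r0 rP] := diff_locally dF0.
    have [n nr] := halving_small x r0.
    have := rP _ nr; have := halfn n x xd; set y := _ *: x => Gx.
    rewrite [X in `|X|](_ : _ = F0 (y + 0) - (F0 0 + D y)) //.
    rewrite addr0 opprD addrA -/(G y) => Gy.
    have n0 : 0 < 2 ^+ n :> C by rewrite exprn_gt0.
    have xE : x = 2 ^+ n *: y by rewrite scalerA divff ?scale1r // gt_eqF.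
    clearbody y; rewrite Gx xE linearZ -scalerBr !normrZ mulrCA ler_pM2l //.
    by rewrite normr_gt0 gt_eqF.
  (* With [a] the norm of the difference, [De] for [a / (`|x| + 1)] would give
     [`|x| + 1 <= `|x|]. *)
  apply/eqP; rewrite -subr_eq0 -normr_eq0; apply/negPn/negP => a0.
  have x0 : 0 < `|x| + 1 by rewrite ltr_wpDl ?normr_ge0.
  have {a0} : 0 < `|G x - D x| by rewrite lt_def a0 normr_ge0.
  move=> a0; have := De _ (divr_gt0 a0 x0).
  rewrite mulrAC ler_pdivlMr // ler_pM2l // => /(lt_le_trans _) lt.
  by have := lt (`|x|); rewrite ltxx ltrDl ltr01 => /(_ isT).
exists (linfun (@r2v _ (tspace T2) \o D \o v2r)) => v.
(* Both sides are additive, so the identity near 0 extends to [v] by writing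
   [v] as a multiple of a small vector. *)
rewrite lfunE /=; have [n nd] := halving_small (v2r v) d0.
have vE : v2r v = ((2 ^+ n)^-1 *: v2r v) *+ (2 ^ n).
  by rewrite -scaler_nat natrX scalerA divff ?scale1r // expf_neq0 ?pnatr_eq0.
rewrite -[v in LHS]v2rK -/(tproj_coord _) -/(tproj_coord _).
rewrite vE 3!raddfMn /= (dP _ nd).1 GD //.
by rewrite raddfMn.
Qed.

Lemma analytic_repP (T1 T2 : complexTorus R) (f : torusHom T1 T2) v :
  f (tproj v) = tproj (analytic_rep f v).
Proof. exact: (xgetPex 0 (lift_exists f)). Qed.

Lemma analytic_rep_unique (T1 T2 : complexTorus R) (f : torusHom T1 T2)
    (F : 'Hom(tspace T1, tspace T2)) :
  (forall v, f (tproj v) = tproj (F v)) -> analytic_rep f = F.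
Proof. by move=> fF; apply: lift_unique => v; rewrite -analytic_repP. Qed.

Lemma analytic_rep_lattice (T1 T2 : complexTorus R) (f : torusHom T1 T2) v :
  v \in tlattice T1 -> analytic_rep f v \in tlattice T2.
Proof.
by rewrite -!tproj_eq0 => /eqP v0; rewrite -analytic_repP v0 raddf0.
Qed.

(** * Matrices of homomorphisms *)

Lemma zbasis_coord_inj (T : complexTorus R) n (b : 'I_n -> tspace T)
    (c d : 'I_n -> int) : is_zbasis (tlattice T) b ->
  \sum_i b i *~ c i = \sum_i b i *~ d i -> c =1 d.
Proof.
move=> [bL bP] cd i.
have cL : \sum_i b i *~ c i \in tlattice T.
  by apply: rpred_sum => l _; rewrite rpredMz.
have [x [_ xU]] := bP _ cL.
have xc : x = finfun c.
  by apply: xU; apply: eq_bigr => l _; rewrite ffunE.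
have xd : x = finfun d.
  by apply: xU; rewrite cd; apply: eq_bigr => l _; rewrite ffunE.
by have := congr1 (fun g : {ffun 'I_n -> int} => g i) (etrans (esym xc) xd);
  rewrite !ffunE.
Qed.

Lemma rational_rep_mxP (T1 T2 : complexTorus R) (f : torusHom T1 T2) b1 b2 :
  is_zbasis (tlattice T1) b1 -> is_zbasis (tlattice T2) b2 ->
  forall j, analytic_rep f (b1 j) = \sum_i b2 i *~ rational_rep_mx f b1 b2 i j.
Proof.
move=> [b1L _] [_ b2P].
apply: (xgetPex 0 (P := [set M : 'M[int]_((tdim T2).*2, (tdim T1).*2) |
           forall j, analytic_rep f (b1 j) = \sum_i b2 i *~ M i j])).
have /fin_all_exists [c cP] j : exists c : {ffun 'I_(tdim T2).*2 -> int},
   analytic_rep f (b1 j) = \sum_i b2 i *~ c i.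
  by have [c [cP _]] := b2P _ (analytic_rep_lattice f (b1L j)); exists c.
exists (\matrix_(i, j) c j i) => j; rewrite cP.
by apply: eq_bigr => i _; rewrite mxE.
Qed.

Lemma rational_rep_mx_unique (T1 T2 : complexTorus R) (f : torusHom T1 T2) b1 b2
    (M : 'M[int]_((tdim T2).*2, (tdim T1).*2)) :
  is_zbasis (tlattice T1) b1 -> is_zbasis (tlattice T2) b2 ->
  (forall j, analytic_rep f (b1 j) = \sum_i b2 i *~ M i j) ->
  rational_rep_mx f b1 b2 = M.
Proof.
move=> hb1 hb2 fM; apply/matrixP => i j; move: i.
by apply: (zbasis_coord_inj hb2); rewrite -rational_rep_mxP.
Qed.

Lemma mulmx_coord (U V : zmodType) (g : {additive U -> V}) (m n p : nat)
    (x : 'I_p -> U) (b : 'I_n -> U) (c : 'I_m -> V)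
    (M : 'M[int]_(n, p)) (N : 'M[int]_(m, n)) :
  (forall j, x j = \sum_i b i *~ M i j) ->
  (forall l, g (b l) = \sum_i c i *~ N i l) ->
  forall j, g (x j) = \sum_i c i *~ (N *m M) i j.
Proof.
move=> xE gE j; rewrite xE raddf_sum.
under eq_bigr => l _ do rewrite raddfMz /= gE mulrz_suml.
rewrite exchange_big; apply: eq_bigr => i _ /=.
by rewrite mxE mulrz_sumr; apply: eq_bigr => l _; rewrite mulrzA.
Qed.

(** The composite of the three analytic representations lifts [f], so it is the
    analytic representation of [f]; only the expansion in the bases is left.
    Three factors are treated at once because a partial composite would first
    have to be proved holomorphic to be a homomorphism of tori. *)
Lemma rational_rep_mx_comp3 (T1 T2 T3 T4 : complexTorus R)
    (f1 : torusHom T1 T2) (f2 : torusHom T2 T3) (f3 : torusHom T3 T4)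
    (f : torusHom T1 T4) b1 b2 b3 b4 :
  is_zbasis (tlattice T1) b1 -> is_zbasis (tlattice T2) b2 ->
  is_zbasis (tlattice T3) b3 -> is_zbasis (tlattice T4) b4 ->
  (forall x, f x = f3 (f2 (f1 x))) ->
  rational_rep_mx f b1 b4 =
  rational_rep_mx f3 b3 b4 *m rational_rep_mx f2 b2 b3 *m
    rational_rep_mx f1 b1 b2.
Proof.
move=> hb1 hb2 hb3 hb4 fE; rewrite -mulmxA.
apply: rational_rep_mx_unique => // j.
have -> : analytic_rep f =
    (analytic_rep f3 \o (analytic_rep f2 \o analytic_rep f1))%VF.
  by apply: analytic_rep_unique => v; rewrite fE !analytic_repP !lfunE /= lfunE.
have rep12 := mulmx_coord (rational_rep_mxP f1 hb1 hb2) (rational_rep_mxP f2 hb2 hb3).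
by rewrite lfunE /= lfunE; exact: mulmx_coord rep12 (rational_rep_mxP f3 hb3 hb4) j.
Qed.

End Torus.

Theorem proposition4 (R : realType) (T1 T2 T1' T2' : complexTorus R)
    (f : torusHom T1 T2) (h : torusHom T1' T2')
    (hiso : exists (h1 : torusHom T1 T1') (h2 : torusHom T2' T2),
       [/\ is_isomorphism h1, is_isomorphism h2 &
           forall x : T1, f x = h2 (h (h1 x))])
    (b1 : 'I_((tdim T1).*2) -> tspace T1)
    (b2 : 'I_((tdim T2).*2) -> tspace T2)
    (b1' : 'I_((tdim T1').*2) -> tspace T1')
    (b2' : 'I_((tdim T2').*2) -> tspace T2')
    (hb1 : is_zbasis (tlattice T1) b1) (hb2 : is_zbasis (tlattice T2) b2)
    (hb1' : is_zbasis (tlattice T1') b1') (hb2' : is_zbasis (tlattice T2') b2') :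
  hom_type f b1 b2 = hom_type h b1' b2'.
Proof.
have [h1 [h2 [[g1 [h1K g1K]] [g2 [h2K g2K]] fE]]] := hiso.
apply: (@mx_type_equiv _ _ _ _ _ _
  (rational_rep_mx h2 b2' b2) (rational_rep_mx h1 b1 b1')
  (rational_rep_mx g2 b2 b2') (rational_rep_mx g1 b1' b1)).
  exact: (rational_rep_mx_comp3 hb1 hb1' hb2' hb2).
apply: (rational_rep_mx_comp3 hb1' hb1 hb2 hb2') => x.
by rewrite fE g1K h2K.
Qed.
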